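(* For any pair $kl\in B$, there exists an optimal solution $u^*$ of $(D)$ such that $r_{kl}(u^* )=R_{kl}$.
   Context: Setting. $X_1,\dots,X_n$ are variables with finite domains $D(X_i)\subset\mathbb{Z}$, and $C$ is a constraint on them, i.e. a set of allowed tuples. A support for $C$ is an allowed tuple $\langle a_1,\dots,a_n\rangle$ with $a_i\in D(X_i)$ for all $i$. $B=\{ij : 1\le i\le n,\ j\in D(X_i)\}$ is the (finite) set of variable/value pairs, where $ij$ is short for $(i,j)$. The characteristic vector of a support is $x\in\{0,1\}^{B}$ with $x_{ij}=1$ iff $a_i=j$; $\mathcal{S}$ is the set of characteristic vectors of the supports of $C$. Each pair has a cost $c_{ij}\in\mathbb{Z}$. Ideal formulation (standing assumption): $A$ is a real $m\times|B|$ matrix (with columns $A_{ij}$, $ij\in B$) and $b\in\mathbb{R}^m$ are such that $\{x\in\mathbb{R}^{B}_+ : Ax\ge b\}=\mathrm{conv}(\mathcal{S})$. $(P)$: $z^*=\min\{cx : Ax\ge b,\ x\in\mathbb{R}^B_+\}$; $(D)$: $\max\{ub : uA\le c,\ u\in\mathbb{R}^m_+\}$. For $kl\in B$, $(P_{|kl})$ is $(P)$ with the additional constraint $x_{kl}=1$, with optimal value $z^*_{|kl}$. Feasibility (assumption of the statement): every pair of $B$ belongs to at least one support of $C$; hence $(P)$, $(D)$ and all $(P_{|kl})$ are feasible and bounded. For feasible $u$ of $(D)$ the reduced cost of $kl$ is $r_{kl}(u)=c_{kl}-uA_{kl}$. $R_{kl}=z^*_{|kl}-z^*$. *)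

(* Defs.v *)
From mathcomp Require Export all_boot all_order all_algebra finmap.
From mathcomp Require Export boolp classical_sets reals convex.

Set Implicit Arguments.
Unset Strict Implicit.
Unset Printing Implicit Defensive.
Import Order.TTheory GRing.Theory Num.Theory.
Local Open Scope classical_set_scope.
Local Open Scope ring_scope.

(* The set B of variable/value pairs ij with j in D(X_i). Vectors of R^B are
   columns of height #|B|, the pair p being the coordinate enum_rank p. *)
Definition pairs (n : nat) (D : 'I_n -> {fset int}) : finType :=
  {i : 'I_n & D i}.

Definition support (n : nat) (D : 'I_n -> {fset int}) (C : set (n.-tuple int)) :
    set (n.-tuple int) :=
  [set a | C a /\ forall i, tnth a i \in D i].

Definition char_vector (R : realType) (n : nat) (D : 'I_n -> {fset int})
    (a : n.-tuple int) : 'cV[R]_#|pairs D| :=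
  \col_p ((tnth a (tag (enum_val p)) == val (tagged (enum_val p)))%:R).

Definition char_vectors (R : realType) (n : nat) (D : 'I_n -> {fset int})
    (C : set (n.-tuple int)) : set 'cV[R]_#|pairs D| :=
  [set char_vector R D a | a in support D C].
Arguments char_vectors R {n} D C _.

Definition convex_hull (R : realType) (V : lmodType R) (S : set V) : set V :=
  smallest (@convex_set R V) S.

Definition cost_vector (R : realType) (n : nat) (D : 'I_n -> {fset int})
    (c : pairs D -> int) : 'rV[R]_#|pairs D| :=
  \row_p (c (enum_val p))%:~R.

Definition primal_feasible (R : realType) (m q : nat) (A : 'M[R]_(m, q))
    (b : 'cV[R]_m) : set 'cV[R]_q :=
  [set x | (forall i, b i 0 <= (A *m x) i 0) /\ (forall p, 0 <= x p 0)].

Definition dual_feasible (R : realType) (m q : nat) (A : 'M[R]_(m, q))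
    (c : 'rV[R]_q) : set 'rV[R]_m :=
  [set u | (forall p, (u *m A) 0 p <= c 0 p) /\ (forall i, 0 <= u 0 i)].

Definition dual_optimal (R : realType) (m q : nat) (A : 'M[R]_(m, q))
    (b : 'cV[R]_m) (c : 'rV[R]_q) : set 'rV[R]_m :=
  [set u | dual_feasible A c u /\
    forall v, dual_feasible A c v -> (v *m b) 0 0 <= (u *m b) 0 0].

(* The least element of E; 0 if there is none. *)
Definition minimum (R : realType) (E : set R) : R :=
  xget 0 [set z | E z /\ lbound E z].

Lemma minimumE (R : realType) (E : set R) (z : R) :
  E z -> lbound E z -> minimum E = z.
Proof.
move=> Ez lbz; apply: xget_unique; first by split.
by move=> y [Ey lby]; apply/le_anti/andP; split; [exact: lby | exact: lbz].
Qed.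

Definition min_cost (R : realType) (q : nat) (c : 'rV[R]_q)
    (F : set 'cV[R]_q) : R :=
  minimum [set (c *m x) 0 0 | x in F].

Definition opt_value (R : realType) (m n : nat) (D : 'I_n -> {fset int})
    (A : 'M[R]_(m, #|pairs D|)) (b : 'cV[R]_m) (c : pairs D -> int) : R :=
  min_cost (cost_vector R c) (primal_feasible A b).

Definition opt_value_at (R : realType) (m n : nat) (D : 'I_n -> {fset int})
    (A : 'M[R]_(m, #|pairs D|)) (b : 'cV[R]_m) (c : pairs D -> int)
    (kl : pairs D) : R :=
  min_cost (cost_vector R c)
    (primal_feasible A b `&` [set x | x (enum_rank kl) 0 = 1]).

Definition reduced_cost (R : realType) (m n : nat) (D : 'I_n -> {fset int})
    (A : 'M[R]_(m, #|pairs D|)) (c : pairs D -> int) (kl : pairs D)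
    (u : 'rV[R]_m) : R :=
  (c kl)%:~R - (u *m col (enum_rank kl) A) 0 0.

Definition cost_increase (R : realType) (m n : nat) (D : 'I_n -> {fset int})
    (A : 'M[R]_(m, #|pairs D|)) (b : 'cV[R]_m) (c : pairs D -> int)
    (kl : pairs D) : R :=
  opt_value_at A b c kl - opt_value A b c.

(* Main.v *)
(* Let e be the cost c lowered by R_kl at the pair kl. On supports e x >= z^*,
   by definition of R_kl when x_kl = 1 and of z^* when x_kl = 0, hence e x >= z^*
   on conv(S). By Farkas some dual feasible u for the cost e has u b >= z^*; it
   is optimal for c and r_kl(u) >= R_kl. The opposite inequality is weak duality
   at an optimal solution of the problem with x_kl = 1. *)
Require Import Defs.
From mathcomp Require Import interval_inference lra.

Set Implicit Arguments.
Unset Strict Implicit.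
Unset Printing Implicit Defensive.
Import Order.TTheory GRing.Theory Num.Theory.
Local Open Scope classical_set_scope.
Local Open Scope ring_scope.

(* Bartl's induction on the rows of M: if the hypothesis fails without the
   first row a, a witness p scaled to a p = 1 gives the projection 1 - p a onto
   the kernel of a, along which a can be eliminated. *)
Lemma farkas (F : realFieldType) (k q : nat) (M : 'M[F]_(k, q))
    (c : 'rV[F]_q) :
    (forall x : 'cV[F]_q,
       (forall i, 0 <= (M *m x) i 0) -> 0 <= (c *m x) 0 0) ->
  exists2 u : 'rV[F]_k, (forall i, 0 <= u 0 i) & u *m M = c.
Proof.
elim: k M c => [|k IH].
  move=> M c cM.
  have c_ge0 (x : 'cV[F]_q) : 0 <= (c *m x) 0 0 by apply: cM => -[].
  exists 0 => [i|]; first by rewrite mxE.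
  rewrite mul0mx; apply/rowP => j; rewrite mxE; apply/le_anti/andP; split.
    by have := c_ge0 (delta_mx j 0); rewrite -colE mxE.
  by have := c_ge0 (- delta_mx j 0); rewrite mulmxN -colE !mxE oppr_ge0.
rewrite -[k.+1]/(1 + k)%N => M c cM.
pose a : 'rV[F]_q := usubmx M.
pose N : 'M[F]_(k, q) := dsubmx M.
have ME : M = col_mx a N by rewrite vsubmxK.
have Mge0 (x : 'cV[F]_q) : 0 <= (a *m x) 0 0 -> (forall i, 0 <= (N *m x) i 0) ->
    0 <= (c *m x) 0 0.
  move=> ax Nx; apply: cM => i; rewrite ME mul_col_mx.
  case: (split_ordP i) => j ->; last by rewrite col_mxEd.
  by rewrite col_mxEu (ord1 j).
have [cN|/existsNP[y /not_implyP[Ny /negP]]] :=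
    pselect (forall x : 'cV[F]_q,
      (forall i, 0 <= (N *m x) i 0) -> 0 <= (c *m x) 0 0).
  have [u u0 uN] := IH N c cN.
  exists (row_mx (0 : 'rV[F]_1) u).
    move=> i; case: (split_ordP i) => j ->.
      by rewrite row_mxEl mxE.
    by rewrite row_mxEr.
  by rewrite ME mul_row_col mul0mx add0r.
rewrite -ltNge => cy.
have ay : (a *m y) 0 0 < 0.
  by rewrite ltNge; apply/negP => ay; move: cy; rewrite ltNge Mge0.
pose p := ((a *m y) 0 0)^-1 *: y.
have ap : a *m p = 1%:M.
  rewrite -scalemxAr [X in _ *: X]mx11_scalar scale_scalar_mx mulVf //.
  by rewrite lt_eqF.
have ayV : ((a *m y) 0 0)^-1 < 0 by rewrite invr_lt0.
have Np i : (N *m p) i 0 <= 0.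
  by rewrite -scalemxAr mxE nmulr_rle0.
have cp : 0 <= (c *m p) 0 0.
  by rewrite -scalemxAr mxE nmulr_rge0 // ltW.
have [|u u0 uP] := IH (N *m (1%:M - p *m a)) (c *m (1%:M - p *m a)).
  move=> x NPx; rewrite -mulmxA; apply: Mge0.
    by rewrite mulmxA mulmxBr mulmx1 mulmxA ap mul1mx subrr mul0mx mxE.
  by move=> i; rewrite mulmxA.
exists (row_mx (c *m p - u *m N *m p) u).
  move=> i; case: (split_ordP i) => j ->; last by rewrite row_mxEr.
  rewrite row_mxEl (ord1 j) mxE addr_ge0 // -mulmxA !mxE oppr_ge0.
  by apply: sumr_le0 => l _; rewrite mulr_ge0_le0.
rewrite ME mul_row_col mulmxBl.
move: uP; rewrite !mulmxBr !mulmx1 !mulmxA => uP.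
by rewrite -addrA [- _ + _]addrC uP addrC subrK.
Qed.

(* Farkas applied to the cone over the feasible set; its boundary consists of
   the directions of recession. *)
Lemma affine_farkas (R : realType) (m q : nat) (A : 'M[R]_(m, q))
    (b : 'cV[R]_m) (c : 'rV[R]_q) (z : R) :
    primal_feasible A b !=set0 ->
    (forall x, primal_feasible A b x -> z <= (c *m x) 0 0) ->
  exists2 u, dual_feasible A c u & z <= (u *m b) 0 0.
Proof.
move=> [x0 [Ax0 x00]] cz.
pose M := col_mx (row_mx A b)
  (col_mx (row_mx (1%:M : 'M[R]_q) 0) (row_mx 0 (- 1%:M : 'M[R]_1))).
have [y My|u u0] := @farkas _ _ _ M (row_mx c z%:M).
  pose x := usubmx y; pose t := - dsubmx y 0 0.
  have yE : y = col_mx x (- t%:M).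
    by rewrite -[LHS]vsubmxK; congr col_mx; rewrite /t raddfN /= opprK -mx11_scalar.
  clearbody x t.
  have MyE : M *m y = col_mx (A *m x - t *: b) (col_mx x t%:M).
    rewrite yE !mul_col_mx !mul_row_col !mul0mx mul1mx addr0 add0r mulNmx mul1mx.
    by rewrite opprK mulmxN mul_mx_scalar.
  have Ax i : t * b i 0 <= (A *m x) i 0.
    by have := My (lshift _ i); rewrite MyE col_mxEu !mxE subr_ge0.
  have x_ge0 j : 0 <= x j 0.
    by have := My (rshift _ (lshift _ j)); rewrite MyE col_mxEd col_mxEu.
  have t_ge0 : 0 <= t.
    have := My (rshift _ (rshift _ 0)).
    by rewrite MyE !col_mxEd mxE eqxx mulr1n.
  suff : t * z <= (c *m x) 0 0.
    rewrite yE mul_row_col mulmxN mul_mx_scalar !mxE eqxx mulr1n.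
    by rewrite subr_ge0.
  move: t_ge0; rewrite le_eqVlt => /orP[/eqP t0|t_gt0]; last first.
    have : z <= (c *m (t^-1 *: x)) 0 0.
      apply: cz; split => [i|j].
        by rewrite -scalemxAr mxE ler_pdivlMl.
      by rewrite mxE mulr_ge0 // invr_ge0 ltW.
    by rewrite -scalemxAr mxE ler_pdivlMl.
  rewrite -t0 mul0r leNgt; apply/negP => cx.
  pose s := (z - 1 - (c *m x0) 0 0) / (c *m x) 0 0.
  have cx0 := cz _ (conj Ax0 x00).
  have s_ge0 : 0 <= s by rewrite mulr_le0 ?invr_le0 ?(ltW cx)//; lra.
  have : z <= (c *m (x0 + s *: x)) 0 0.
    apply: cz; split => [i|j].
      rewrite mulmxDr -scalemxAr !mxE -[leLHS]addr0 lerD //.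
        by have := Ax0 i; rewrite mxE.
      by have := Ax i; rewrite -t0 mul0r mxE => ?; rewrite mulr_ge0.
    by rewrite !mxE addr_ge0 // mulr_ge0.
  rewrite mulmxDr -scalemxAr.
  have sE : s * (c *m x) 0 0 = z - 1 - (c *m x0) 0 0.
    by rewrite divfK // lt_eqF.
  rewrite mxE [X in _ + X]mxE sE; lra.
pose v := lsubmx u; pose w := lsubmx (rsubmx u); pose r := rsubmx (rsubmx u).
have -> : u = row_mx v (row_mx w r) by rewrite !hsubmxK.
rewrite /M mul_row_col mul_row_col !mul_mx_row !mulmx0 mulmx1 mulmxN mulmx1.
rewrite !add_row_mx addr0 add0r => /eq_row_mx[vA vb].
have w_ge0 j : 0 <= w 0 j by rewrite !mxE.
have r_ge0 : 0 <= r 0 0 by rewrite !mxE.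
exists v; first split => [j|i].
- by rewrite -vA [leRHS]mxE lerDl.
- by rewrite mxE.
- have /matrixP/(_ 0 0) := vb.
  by rewrite mxE [X in _ + X]mxE [RHS]mxE eqxx mulr1n => <-; rewrite gerBl.
Qed.

Lemma min_finite_image (R : realType) (V : Type) (T : finType) (g : T -> V)
    (S : set V) (f : V -> R) :
    S !=set0 -> S `<=` range g ->
  exists2 x, S x & forall y, S y -> f x <= f y.
Proof.
move=> [x Sx] Sg; have [t0 _ t0x] := Sg _ Sx.
have P0 : `[<S (g t0)>] by apply/asboolP; rewrite t0x.
have [t /asboolP St tmin] :=
  Order.TotalTheory.arg_minP (P := fun t => `[<S (g t)>]) (f \o g) P0.
exists (g t) => // y Sy; have [s _ sy] := Sg _ Sy.
by rewrite -sy; apply/tmin/asboolP; rewrite sy.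
Qed.

Lemma char_vectors_finite (R : realType) (n : nat) (D : 'I_n -> {fset int})
    (C : set (n.-tuple int)) :
  char_vectors R D C `<=`
    range (fun v : {ffun 'I_#|pairs D| -> bool} => \col_p (v p)%:R : 'cV[R]__).
Proof.
move=> _ [a _ <-].
exists [ffun p => tnth a (tag (enum_val p)) == val (tagged (enum_val p))] => //.
by apply/colP => p; rewrite !mxE ffunE.
Qed.

Lemma halfspace_convex (R : realType) (q : nat) (c : 'rV[R]_q) (z : R) :
  @convex_set R 'cV[R]_q [set x | z <= (c *m x) 0 0].
Proof.
move=> x y l; rewrite !inE /= => cx cy.
have -> : conv l x y =
  l%:num *: (x : 'cV[R]_q) + (1 - l%:num) *: (y : 'cV[R]_q) by [].
rewrite mulmxDr -!scalemxAr mxE [X in X + _]mxE [X in _ + X]mxE.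
have l0 : 0 <= l%:num by [].
have l1 : l%:num <= 1 by [].
nra.
Qed.

Lemma reduced_cost_le_gap (R : realType) (m q : nat) (A : 'M[R]_(m, q))
    (b : 'cV[R]_m) (c : 'rV[R]_q) (u : 'rV[R]_m) (x : 'cV[R]_q) (k : 'I_q) :
    dual_feasible A c u -> primal_feasible A b x ->
  (c - u *m A) 0 k * x k 0 <= (c *m x) 0 0 - (u *m b) 0 0.
Proof.
move=> [uA u0] [Ax x0].
have ub : (u *m b) 0 0 <= (u *m A *m x) 0 0.
  by rewrite -mulmxA !mxE; apply: ler_sum => i _; rewrite ler_wpM2l.
suff : (c - u *m A) 0 k * x k 0 <= ((c - u *m A) *m x) 0 0.
  by rewrite mulmxBl [leRHS]mxE [X in _ <= _ + X]mxE; lra.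
rewrite [leRHS]mxE (bigD1 k) //= lerDl; apply: sumr_ge0 => j _.
by rewrite mulr_ge0 // [X in 0 <= X]mxE [X in _ + X]mxE subr_ge0.
Qed.

Theorem mainTheorem5 (R : realType) (n : nat) (D : 'I_n -> {fset int})
    (C : set (n.-tuple int)) (c : pairs D -> int)
    (m : nat) (A : 'M[R]_(m, #|pairs D|)) (b : 'cV[R]_m)
    (ideal : primal_feasible A b = convex_hull (char_vectors R D C))
    (feasible : forall ij : pairs D, exists2 a : n.-tuple int,
       support D C a & tnth a (tag ij) = val (tagged ij)) :
  forall kl : pairs D, exists2 u : 'rV[R]_m,
    dual_optimal A b (cost_vector R c) u &
    reduced_cost A c kl u = cost_increase A b c kl.
Proof.
move=> kl; set k := enum_rank kl.
set S := char_vectors R D C in ideal *.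
set d := cost_vector R c.
have SP : S `<=` primal_feasible A b by rewrite ideal; exact: sub_gen_smallest.
pose S1 := S `&` [set x | x k 0 = 1].
have S1n0 : S1 !=set0.
  have [a Ca akl] := feasible kl; exists (char_vector R D a); split.
    by exists a.
  by rewrite /= mxE /k enum_rankK akl eqxx.
have S_finite := @char_vectors_finite R n D C.
have [x0 Sx0 x0min] := min_finite_image (fun x => (d *m x) 0 0)
  (subset_nonempty (@subIsetl _ _ _) S1n0) S_finite.
have [x1 [Sx1 /= x1k] x1min] := min_finite_image (fun x => (d *m x) 0 0)
  S1n0 (subset_trans (@subIsetl _ _ _) S_finite).
set z0 := (d *m x0) 0 0 in x0min; set z1 := (d *m x1) 0 0 in x1min.
have hull_min (e : 'rV[R]_#|pairs D|) z : (forall x, S x -> z <= (e *m x) 0 0) ->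
    forall x, primal_feasible A b x -> z <= (e *m x) 0 0.
  move=> Sz; rewrite ideal.
  exact: (smallest_sub (@halfspace_convex R _ e z)).
have optE : opt_value A b c = z0.
  apply: minimumE; first by exists x0 => //; exact: SP.
  by move=> _ [x Px <-]; exact: hull_min Px.
pose e := d - (z1 - z0) *: delta_mx 0 k.
have eE x : (e *m x) 0 0 = (d *m x) 0 0 - (z1 - z0) * x k 0.
  by rewrite mulmxBl -scalemxAl -rowE !mxE.
have eP x : primal_feasible A b x -> z0 <= (e *m x) 0 0.
  apply: hull_min => {}x Sx; rewrite eE.
  have [v _ xv] := S_finite _ Sx.
  have xk : x k 0 = (v k)%:R by rewrite -xv mxE.
  rewrite xk; case vk: (v k) => /=; last by have := x0min _ Sx; lra.
  have : z1 <= (d *m x) 0 0 by apply: x1min; split => //=; rewrite xk vk.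
  lra.
have opt1E : opt_value_at A b c kl = z1.
  apply: minimumE; first by exists x1 => //; split => //; exact: SP.
  by move=> _ [x [Px /= xk] <-]; have := eP _ Px; rewrite eE xk; lra.
have z01 : z0 <= z1 by apply: x0min.
have [u [uA u0] ub] := affine_farkas (ex_intro _ x0 (SP _ Sx0)) eP.
have du : dual_feasible A d u.
  split=> // p; apply: le_trans (uA p) _.
  by rewrite [e 0 p]mxE gerDl !mxE oppr_le0 mulr_ge0 // subr_ge0.
exists u.
  split=> // v dv; apply: le_trans ub.
  have := reduced_cost_le_gap k dv (SP _ Sx0); rewrite -/z0 => gap.
  have : 0 <= (d - v *m A) 0 k * x0 k 0.
    rewrite mulr_ge0 ?(SP _ Sx0).2 // !mxE subr_ge0.
    by have := dv.1 k; rewrite !mxE.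
  lra.
rewrite /cost_increase optE opt1E /reduced_cost -/k colE mulmxA -colE
  [X in _ - X]mxE.
have dk : d 0 k = (c kl)%:~R by rewrite mxE /k enum_rankK.
have ek : e 0 k = d 0 k - (z1 - z0) by rewrite !mxE !eqxx mulr1.
have rk : (d - u *m A) 0 k = d 0 k - (u *m A) 0 k.
  by rewrite [LHS]mxE [X in _ + X]mxE.
have := reduced_cost_le_gap k du (SP _ Sx1); rewrite x1k mulr1 -/z1 rk.
have := uA k; rewrite ek dk; lra.
Qed.
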